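(* Let $\{U_i\}$ be a good open cover of a smooth manifold $M$ and $\{g_{ijk}:U_{ijk}\to\mathbb{T}\}$ a $\mathbb{T}$-valued Cech $2$-cocycle. Let $V_0=\mathrm{Obj}(\mathcal{L}_{g_{ijk}})$, with vector space structure given by $\lambda(\xi,\{f^{\hat\xi}_{ij}\})=(\lambda\xi,\{\lambda f^{\hat\xi}_{ij}\})$ for $\lambda\in\mathbb{R}$ and $(\xi,\{f^{\hat\xi}_{ij}\})+(\eta,\{f^{\hat\eta}_{ij}\})=(\xi+\eta,\{f^{\hat\xi}_{ij}+f^{\hat\eta}_{ij}\})$. Let $V_1$ be the set of collections $\{u_i:U_i\to i\mathbb{R}\}$ of smooth functions, with vector space structure given by addition and scalar multiplication of functions. Then $V=V_0\oplus V_1$ has the structure of a 2-term $L_\infty$-algebra with (1) $d:V_1\to V_0$ given by $\{u_i\}\mapsto(0,\{u_i-u_j\})$; (2) $[\cdot,\cdot]:V\otimes V\to V$ given by (a) $[(\xi,\{f^{\hat\xi}_{ij}\}),(\eta,\{f^{\hat\eta}_{ij}\})]=([\xi,\eta],\{\xi(f^{\hat\eta}_{ij})-\eta(f^{\hat\xi}_{ij})\})$ for $(\xi,\{f^{\hat\xi}_{ij}\}),(\eta,\{f^{\hat\eta}_{ij}\})\in V_0$, (b) $[(\xi,\{f^{\hat\xi}_{ij}\}),\{u_i\}]=\{\xi(u_i)\}=-[\{u_i\},(\xi,\{f^{\hat\xi}_{ij}\})]$ for $(\xi,\{f^{\hat\xi}_{ij}\})\in V_0$, $\{u_i\}\in V_1$,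 (c) $[\{u_i\},\{v_i\}]=0$ for $\{u_i\},\{v_i\}\in V_1$; (3) $J=0$.
   Context: $\mathbb{T}$ is the circle group with Lie algebra $i\mathbb{R}$; $d\log(g)=g^{-1}dg$; $U_{ij}=U_i\cap U_j$, etc. A good open cover is one whose nonempty finite intersections are contractible. A $\mathbb{T}$-valued Cech $2$-cocycle is a collection of smooth $g_{ijk}:U_{ijk}\to\mathbb{T}$ with $g_{jkl}g_{ikl}^{-1}g_{ijl}g_{ijk}^{-1}=1$ on $U_{ijkl}$. An object of $\mathcal{L}_{g_{ijk}}$ is a pair $(\xi,\{f_{ij}\})$ with $\xi$ a vector field on $M$ and $f_{ij}:U_{ij}\to i\mathbb{R}$ smooth functions satisfying $f_{jk}-f_{ik}+f_{ij}=\iota_\xi d\log(g_{ijk})$ on $U_{ijk}$. A 2-term $L_\infty$-algebra is a 2-term chain complex of vector spaces $d:V_1\to V_0$ equipped with an antisymmetric chain map $[\cdot,\cdot]:V\otimes V\to V$ and an antisymmetric chain homotopy $J:V\otimes V\otimes V\to V$ from the chain map $x\otimes y\otimes z\mapsto[x,[y,z]]$ to the chain map $x\otimes y\otimes z\mapsto[[x,y],z]+[y,[x,z]]$, such that for all $x,y,z,w\in V$ $$[x,J(y,z,w)]+J(x,[y,z],w)+J(x,z,[y,w])+[J(x,y,z),w]+[z,J(x,y,w)]$$ $$=J(x,y,[z,w])+J([x,y],z,w)+[y,J(x,z,w)]+J(y,[x,z],w)+J(y,z,[x,w]).$$ Explicitly, the bracket being a chain map means $d[x,h]=[x,dh]$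 and $[dh,k]=[h,dk]$ for $x\in V_0$, $h,k\in V_1$; antisymmetry means $[x,y]=-[y,x]$ (including $x\in V_0,y\in V_1$). *)

(* Defs.v *)
From HB Require Import structures.
From mathcomp Require Import all_boot all_order all_algebra.
From mathcomp Require Import all_classical all_reals all_analysis.
From mathcomp Require Import complex.
Set Implicit Arguments.
Unset Strict Implicit.
Unset Printing Implicit Defensive.
Import Order.TTheory GRing.Theory Num.Theory numFieldNormedType.Exports.
Local Open Scope classical_set_scope.
Local Open Scope ring_scope.

Section EuclideanSmoothness.
Variables (R : realType) (n : nat).
Implicit Types (A : set 'rV[R]_n) (f g : 'rV[R]_n -> R).

Fixpoint Ck (k : nat) A f : Prop :=
  (forall x, A x -> {for x, continuous f}) /\
  if k is k'.+1 then
    forall i : 'I_n, (forall x, A x -> derivable f x (delta_mx 0 i)) /\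
      Ck k' A (fun x => 'D_(delta_mx 0 i) f x)
  else True.

Definition smooth A f : Prop := forall k, Ck k A f.

Lemma Ck_ext k A f g : open A -> (forall x, A x -> f x = g x) ->
  Ck k A f -> Ck k A g.
Proof.
move=> oA.
have nfg (u v : 'rV[R]_n -> R) x : (forall x, A x -> u x = v x) -> A x ->
    \forall y \near x, u y = v y.
  by move=> uv Ax; apply: filterS (open_nbhs_nbhs (conj oA Ax)) => y /uv.
have cont (u v : 'rV[R]_n -> R) x : (forall x, A x -> u x = v x) -> A x ->
    {for x, continuous u} -> {for x, continuous v}.
  move=> uv Ax cu; rewrite /prop_for /continuous_at -uv //.
  exact: cvg_trans (near_eq_cvg (nfg _ _ _ uv Ax)) cu.
elim: k f g => [|k IH] f g fg /= [cf df].
  by split => // x Ax; apply: (cont f) => //; exact: cf.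
split; first by move=> x Ax; apply: (cont f) => //; exact: cf.
move=> i; have [d1 d2] := df i; split.
  by move=> x Ax; apply: near_eq_derivable (d1 x Ax); exact: nfg.
by apply: IH d2 => x Ax; apply/near_eq_derive/nfg.
Qed.

Lemma Ck0 k A : Ck k A (fun=> 0).
Proof.
elim: k => [|k IH] /=; first by split => // x _; exact: cst_continuous.
split; first by move=> x _; exact: cst_continuous.
move=> i; split; first by move=> x _; exact: derivable_cst.
have -> // : (fun x => 'D_(delta_mx 0 i) (fun=> 0 : R) x) =
  (fun=> 0) :> ('rV[R]_n -> R).
by apply/funext => x; exact: derive_cst.
Qed.

Lemma CkP k A (a : R) f g : open A -> Ck k A f -> Ck k A g ->
  Ck k A (fun x => a * f x + g x).
Proof.
move=> oA.
have cont (u v : 'rV[R]_n -> R) x : {for x, continuous u} ->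
    {for x, continuous v} -> {for x, continuous (fun y => a * u y + v y)}.
  by move=> cu cv; exact: (cvgD (cvgM (cvg_cst a) cu) cv).
elim: k f g => [|k IH] f g /= [cf df] [cg dg].
  by split => // x Ax; apply: cont; [exact: cf | exact: cg].
split; first by move=> x Ax; apply: cont; [exact: cf | exact: cg].
move=> i; have [df1 df2] := df i; have [dg1 dg2] := dg i; split.
  move=> x Ax; apply: (@derivableD _ _ _ (a \*: f) g); last exact: dg1.
  by apply: derivableZ; exact: df1.
apply: Ck_ext (IH _ _ df2 dg2) => // x Ax.
rewrite -[RHS]/('D_(delta_mx 0 i) ((a \*: f) + g) x) deriveD.
- by rewrite deriveZ //; exact: df1.
- by apply: derivableZ; exact: df1.
- exact: dg1.
Qed.

End EuclideanSmoothness.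

(* [to_coord] and [of_coord] are total; only their values on [dom] and [img]
   matter. *)
Record chart (R : realType) (n : nat) (M : topologicalType) := Chart {
  dom : set M;
  img : set 'rV[R]_n;
  to_coord : M -> 'rV[R]_n;
  of_coord : 'rV[R]_n -> M;
  dom_open : open dom;
  img_open : open img;
  to_coord_img : forall p, dom p -> img (to_coord p);
  of_coord_dom : forall y, img y -> dom (of_coord y);
  to_coordK : forall p, dom p -> of_coord (to_coord p) = p;
  of_coordK : forall y, img y -> to_coord (of_coord y) = y;
  to_coord_continuous : {within dom, continuous to_coord};
  of_coord_continuous : {within img, continuous of_coord}
}.

Definition smooth_transition R n M (c d : chart R n M) : Prop :=
  forall i : 'I_n, smooth [set y | img c y /\ dom d (of_coord c y)]
    (fun y => to_coord d (of_coord c y) 0 i).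

(* The atlas need not be maximal. *)
Record smooth_manifold (R : realType) (n : nat) := SmoothManifold {
  space :> topologicalType;
  manifold_hausdorff : hausdorff_space space;
  manifold_second_countable : @second_countable space;
  atlas : set (chart R n space);
  atlas_cover : forall p : space, exists2 c, atlas c & dom c p;
  atlas_smooth : forall c d, atlas c -> atlas d -> smooth_transition c d
}.

Section SmoothFunctions.
Variables (R : realType) (n : nat) (M : smooth_manifold R n).
Implicit Types (W : set M) (f g : M -> R) (p : M).

(* A function on an open set W is represented by a total function of which only
   the values on W matter. *)
Definition smooth_on W f : Prop :=
  forall c, atlas c ->
    smooth [set y | img c y /\ W (of_coord c y)] (f \o of_coord c).

Definition smooth_near p f : Prop :=
  exists2 W, open_nbhs p W & smooth_on W f.

(* [Rcomplex R] is the field C with its structure of real vector space. *)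
Definition csmooth_on W (u : M -> Rcomplex R) : Prop :=
  smooth_on W (fun p => complex.Re (u p)) /\
  smooth_on W (fun p => complex.Im (u p)).

Lemma smooth_on0 W : smooth_on W (fun=> 0).
Proof. by move=> c _ k; exact: Ck0. Qed.

Lemma open_in_chart W (c : chart R n M) : open W ->
  open [set y | img c y /\ W (of_coord c y)].
Proof.
move=> oW.
have oI := @img_open _ _ _ c.
have cc := @of_coord_continuous _ _ _ c.
rewrite continuous_open_subspace // in cc.
rewrite openE => y [Iy Wy].
have h1 : nbhs y (img c) by exact: open_nbhs_nbhs.
have h2 : nbhs y (of_coord c @^-1` W).
  by apply: (cc y); [exact: mem_set | exact: open_nbhs_nbhs].
by apply: filterS2 h1 h2.
Qed.

Lemma smooth_onP W (a : R) f g : open W -> smooth_on W f -> smooth_on W g ->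
  smooth_on W (fun p => a * f p + g p).
Proof.
move=> oW sf sg c Ac k.
by apply: (@CkP _ _ k _ a (f \o of_coord c) (g \o of_coord c));
  [exact: open_in_chart | exact: sf | exact: sg].
Qed.

Lemma csmooth_on0 W : csmooth_on W (fun=> 0).
Proof. by split; exact: smooth_on0. Qed.

Lemma csmooth_onP W (a : R) (u v : M -> Rcomplex R) : open W ->
  csmooth_on W u -> csmooth_on W v -> csmooth_on W (a *: u + v).
Proof.
have reE : (fun p => complex.Re ((a *: u + v) p)) =
    (fun p => a * complex.Re (u p) + complex.Re (v p)).
  apply/funext => p; rewrite -[(_ + _) p]/(a *: u p + v p).
  by case: (u p) (v p) => ? ? [].
have imE : (fun p => complex.Im ((a *: u + v) p)) =
    (fun p => a * complex.Im (u p) + complex.Im (v p)).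
  apply/funext => p; rewrite -[(_ + _) p]/(a *: u p + v p).
  by case: (u p) (v p) => ? ? [].
by move=> oW [ru iu] [rv iv]; split; rewrite ?reE ?imE; exact: smooth_onP.
Qed.

End SmoothFunctions.

Section VectorFields.
Variables (R : realType) (n : nat) (M : smooth_manifold R n).

(* Tangent vectors at p are the derivations of the algebra of germs at p of
   smooth functions; the value on a function that is not smooth near p is
   set to 0, so that equal tangent vectors are equal functions. *)
Record tangent_vector (p : M) (v : (M -> R) -> R) : Prop := TangentVector {
  tangent_germ : forall f g, smooth_near p f ->
    (\forall q \near p, f q = g q) -> v f = v g;
  tangent_linear : forall (a : R) f g, smooth_near p f -> smooth_near p g ->
    v (fun q => a * f q + g q) = a * v f + v g;
  tangent_leibniz : forall f g, smooth_near p f -> smooth_near p g ->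
    v (fun q => f q * g q) = f p * v g + v f * g p;
  tangent_junk : forall f, ~ smooth_near p f -> v f = 0
}.

Record is_vector_field (X : M -> (M -> R) -> R) : Prop := IsVectorField {
  vector_field_tangent : forall p, tangent_vector p (X p);
  vector_field_smooth : forall W f, open W -> smooth_on W f ->
    smooth_on W (fun p => X p f)
}.

Definition vector_field_pred : {pred M -> (M -> R) -> R} :=
  fun X => `[< is_vector_field X >].

Lemma vector_field_submod_closed : submod_closed vector_field_pred.
Proof.
split.
  apply/asboolP; split=> [p|W f _ _]; last exact: smooth_on0.
  split=> //.
  - by move=> a f g _ _; rewrite mulr0 addr0.
  - by move=> f g _ _; rewrite mulr0 mul0r addr0.
move=> a X Y /asboolP[tX sX] /asboolP[tY sY]; apply/asboolP; split.
  move=> p; have [gX lX bX jX] := tX p; have [gY lY bY jY] := tY p.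
  split=> [f g sf fg|b f g sf sg|f g sf sg|f nf].
  - by rewrite -[LHS]/(a * X p f + Y p f) (gX f g sf fg) (gY f g sf fg).
  - rewrite -[LHS]/(a * X p _ + Y p _) lX // lY //.
    rewrite -[X in _ = b * X + _]/(a * X p f + Y p f).
    rewrite -[X in _ = _ + X]/(a * X p g + Y p g).
    by rewrite !mulrDr addrACA !mulrA [b * a]mulrC.
  - rewrite -[LHS]/(a * X p _ + Y p _) bX // bY //.
    rewrite -[X in _ = f p * X + _]/(a * X p g + Y p g).
    rewrite -[X in _ = _ + X * g p]/(a * X p f + Y p f).
    by rewrite !mulrDr mulrDl addrACA !mulrA [f p * a]mulrC.
  - by rewrite -[LHS]/(a * X p f + Y p f) jX // jY // mulr0 addr0.
by move=> W f oW sf; apply: smooth_onP => //; [exact: sX | exact: sY].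
Qed.

HB.instance Definition _ := GRing.isSubmodClosed.Build R
  (M -> (M -> R) -> R) vector_field_pred vector_field_submod_closed.

Record vector_field := VectorField {
  vector_field_fun :> M -> (M -> R) -> R;
  _ : vector_field_fun \in vector_field_pred
}.

HB.instance Definition _ := [isSub for vector_field_fun].
HB.instance Definition _ := [Choice of vector_field by <:].
HB.instance Definition _ := [SubChoice_isSubLmodule of vector_field by <:].

(* The guard keeps the convention of [tangent_junk]. *)
Definition lie_bracket (X Y : vector_field) : M -> (M -> R) -> R :=
  fun p f => if `[< smooth_near p f >]
    then X p (fun q => Y q f) - Y p (fun q => X q f) else 0.

Definition lie_derivative (X : vector_field) (u : M -> Rcomplex R) :
    M -> Rcomplex R :=
  fun p => (X p (fun q => complex.Re (u q)) +i*
            X p (fun q => complex.Im (u q)))%C.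

(* The contraction of X with g^-1 dg. *)
Definition iota_dlog (X : vector_field) (g : M -> Rcomplex R) :
    M -> Rcomplex R :=
  fun p => (g p)^-1 * lie_derivative X g p.

End VectorFields.

Definition contractible (R : realType) (T : topologicalType) (A : set T) :=
  exists x0, A x0 /\ exists H : T * R -> T,
    [/\ {within A `*` `[0, 1], continuous H},
        forall x t, A x -> 0 <= t <= 1 -> A (H (x, t)),
        forall x, A x -> H (x, 0) = x &
        forall x, A x -> H (x, 1) = x0].

Record good_open_cover (R : realType) (n : nat) (M : smooth_manifold R n)
    (I : Type) := GoodOpenCover {
  cover_set :> I -> set M;
  cover_open : forall i, open (cover_set i);
  cover_total : \bigcup_i cover_set i = [set: M];
  cover_good : forall J : set I, finite_set J -> J !=set0 ->
    \bigcap_(i in J) cover_set i !=set0 ->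
    contractible R (\bigcap_(i in J) cover_set i)
}.

(* [g i j k] matters only on U_ijk. *)
Record cech_2cocycle (R : realType) (n : nat) (M : smooth_manifold R n)
    (I : Type) (U : good_open_cover M I) := Cech2Cocycle {
  cocycle_fun :> I -> I -> I -> M -> Rcomplex R;
  cocycle_smooth : forall i j k,
    csmooth_on (U i `&` U j `&` U k) (cocycle_fun i j k);
  cocycle_circle : forall i j k p, U i p -> U j p -> U k p ->
    `|cocycle_fun i j k p| = 1;
  cocycle_eq : forall i j k l p, U i p -> U j p -> U k p -> U l p ->
    cocycle_fun j k l p * (cocycle_fun i k l p)^-1 *
    cocycle_fun i j l p * (cocycle_fun i j k p)^-1 = 1
}.

Section CechData.
Variables (R : realType) (n : nat) (M : smooth_manifold R n) (I : Type).
Variables (U : good_open_cover M I).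

(* Smooth functions W -> iR, represented by their extension by 0 to M, so that
   equality of functions on W is equality of representatives. *)
Record is_iR_function (W : set M) (u : M -> Rcomplex R) : Prop :=
    IsIRFunction {
  iR_smooth : csmooth_on W u;
  iR_imaginary : forall p, W p -> complex.Re (u p) = 0;
  iR_ext0 : forall p, ~ W p -> u p = 0
}.

Lemma is_iR_function0 W : is_iR_function W 0.
Proof. by split => //; exact: csmooth_on0. Qed.

Lemma is_iR_functionP W (a : R) u v : open W ->
  is_iR_function W u -> is_iR_function W v -> is_iR_function W (a *: u + v).
Proof.
move=> oW [su iu zu] [sv iv zv]; split; first exact: csmooth_onP.
- move=> p Wp; rewrite -[_ p]/(a *: u p + v p).
  move: (iu p Wp) (iv p Wp).
  by case: (u p) (v p) => [x y] [z t] /= -> ->; rewrite mulr0 addr0.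
- by move=> p Wp; rewrite -[_ p]/(a *: u p + v p) zu // zv // scaler0 addr0.
Qed.

Definition iR_cochain_pred : {pred I -> M -> Rcomplex R} :=
  fun u => `[< forall i, is_iR_function (U i) (u i) >].

Lemma iR_cochain_submod_closed : submod_closed iR_cochain_pred.
Proof.
split; first by apply/asboolP => i; exact: is_iR_function0.
move=> a u v /asboolP hu /asboolP hv; apply/asboolP => i.
by apply: is_iR_functionP => //; exact: cover_open.
Qed.

HB.instance Definition _ := GRing.isSubmodClosed.Build R
  (I -> M -> Rcomplex R) iR_cochain_pred iR_cochain_submod_closed.

Record iR_cochain := IRCochain {
  iR_cochain_fun :> I -> M -> Rcomplex R;
  _ : iR_cochain_fun \in iR_cochain_pred
}.

HB.instance Definition _ := [isSub for iR_cochain_fun].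
HB.instance Definition _ := [Choice of iR_cochain by <:].
HB.instance Definition _ := [SubChoice_isSubLmodule of iR_cochain by <:].

Variable g : cech_2cocycle U.

Definition cech_object_pred :
    {pred vector_field M * (I -> I -> M -> Rcomplex R)} :=
  fun x => `[< (forall i j, is_iR_function (U i `&` U j) (x.2 i j)) /\
    (forall i j k p, U i p -> U j p -> U k p ->
      x.2 j k p - x.2 i k p + x.2 i j p = iota_dlog x.1 (g i j k) p) >].

Lemma iota_dlogP (a : R) (X Y : vector_field M) (h : M -> Rcomplex R) p :
  iota_dlog (a *: X + Y) h p = a *: iota_dlog X h p + iota_dlog Y h p.
Proof.
rewrite /iota_dlog.
have -> : lie_derivative (a *: X + Y) h p =
    a *: lie_derivative X h p + lie_derivative Y h p by [].
have scaleE (z : Rcomplex R) : a *: z = (a%:C)%C * z.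
  by case: z => x y; congr (_ +i* _)%C; rewrite mul0r ?subr0 ?addr0.
by rewrite mulrDr !scaleE mulrCA.
Qed.

Lemma cech_object_submod_closed : submod_closed cech_object_pred.
Proof.
split.
  apply/asboolP; split; first by move=> i j; exact: is_iR_function0.
  move=> i j k p _ _ _ /=; rewrite subr0 add0r.
  by have := iota_dlogP 0 0 0 (g i j k) p; rewrite !scale0r !add0r => ->;
    rewrite /iota_dlog -[lie_derivative _ _ _]/(0 : Rcomplex R) mulr0.
move=> a [X u] [Y v] /asboolP[/= rx hx] /asboolP[/= ry hy].
apply/asboolP; split.
  move=> i j.
  have := is_iR_functionP a (openI (@cover_open _ _ _ _ U i)
    (@cover_open _ _ _ _ U j)) (rx i j) (ry i j).
  by [].
move=> i j k p Ui Uj Uk /=.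
rewrite iota_dlogP -hx // -hy //.
have E l m : (a *: u + v) l m p = a *: u l m p + v l m p by [].
by rewrite !E !scalerDr scalerN opprD (addrACA (a *: _)) (addrACA (a *: _ + _)).
Qed.

HB.instance Definition _ := GRing.isSubmodClosed.Build R
  (vector_field M * (I -> I -> M -> Rcomplex R))%type
  cech_object_pred cech_object_submod_closed.

Record cech_object := CechObject {
  cech_object_val : vector_field M * (I -> I -> M -> Rcomplex R);
  _ : cech_object_val \in cech_object_pred
}.

HB.instance Definition _ := [isSub for cech_object_val].
HB.instance Definition _ := [Choice of cech_object by <:].
HB.instance Definition _ := [SubChoice_isSubLmodule of cech_object by <:].

Definition ob_field (x : cech_object) : vector_field M :=
  (cech_object_val x).1.
Definition ob_fun (x : cech_object) : I -> I -> M -> Rcomplex R :=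
  (cech_object_val x).2.

End CechData.

Section TwoTerm.
Variables (R : fieldType) (V0 V1 : lmodType R).
Local Notation V := (V0 * V1)%type.

Definition in0 (x : V0) : V := (x, 0).
Definition in1 (h : V1) : V := (0, h).

Definition total_d (d : V1 -> V0) (x : V) : V := in0 (d x.2).

(* The involution (-1)^degree, which carries the signs of the differential of
   a tensor product: d (x (x) y) = d x (x) y + (-1)^|x| x (x) d y. *)
Definition parity (x : V) : V := (x.1, - x.2).

Record two_term_Linfty := TwoTermLinfty {
  Ld : {linear V1 -> V0};
  Lbr : V -> V -> V;
  LJ : V -> V -> V -> V;
  Lbr_linear_l : forall y, linear (Lbr^~ y);
  Lbr_linear_r : forall x, linear (Lbr x);
  (* The bracket has degree 0. *)
  Lbr_00 : forall x y, (Lbr (in0 x) (in0 y)).2 = 0;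
  Lbr_01 : forall x h, (Lbr (in0 x) (in1 h)).1 = 0;
  Lbr_10 : forall h x, (Lbr (in1 h) (in0 x)).1 = 0;
  Lbr_11 : forall h k, Lbr (in1 h) (in1 k) = 0;
  Lbr_chain : forall x y, total_d Ld (Lbr x y) =
    Lbr (total_d Ld x) y + Lbr (parity x) (total_d Ld y);
  Lbr_anti : forall x y, Lbr x y = - Lbr y x;
  LJ_linear_1 : forall y z, linear (fun x => LJ x y z);
  LJ_linear_2 : forall x z, linear (fun y => LJ x y z);
  LJ_linear_3 : forall x y, linear (LJ x y);
  (* The homotopy has degree 1. *)
  LJ_000 : forall x y z, (LJ (in0 x) (in0 y) (in0 z)).1 = 0;
  LJ_1 : forall h y z, LJ (in1 h) y z = 0;
  LJ_2 : forall x h z, LJ x (in1 h) z = 0;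
  LJ_3 : forall x y h, LJ x y (in1 h) = 0;
  LJ_homotopy : forall x y z,
    total_d Ld (LJ x y z) +
    (LJ (total_d Ld x) y z + LJ (parity x) (total_d Ld y) z +
     LJ (parity x) (parity y) (total_d Ld z)) =
    (Lbr (Lbr x y) z + Lbr y (Lbr x z)) - Lbr x (Lbr y z);
  LJ_anti_12 : forall x y z, LJ x y z = - LJ y x z;
  LJ_anti_23 : forall x y z, LJ x y z = - LJ x z y;
  LJ_coherence : forall x y z w,
    Lbr x (LJ y z w) + LJ x (Lbr y z) w + LJ x z (Lbr y w) +
      Lbr (LJ x y z) w + Lbr z (LJ x y w) =
    LJ x y (Lbr z w) + LJ (Lbr x y) z w + Lbr y (LJ x z w) +
      LJ y (Lbr x z) w + LJ y z (Lbr x w)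
}.

End TwoTerm.

Arguments in0 {R V0 V1} x.
Arguments in1 {R V0 V1} h.

(* Main.v *)
Require Import Defs.
From HB Require Import structures.
From mathcomp Require Import all_boot all_order all_algebra.
From mathcomp Require Import all_classical all_reals all_analysis.
From mathcomp Require Import complex.
From mathcomp Require Import ring.
Set Implicit Arguments.
Unset Strict Implicit.
Unset Printing Implicit Defensive.
Import Order.TTheory GRing.Theory Num.Theory numFieldNormedType.Exports.
Local Open Scope classical_set_scope.
Local Open Scope ring_scope.

(* Restricted to an open set W, the Lie derivative makes the iR-valued functions
   on W a module over the Lie algebra of vector fields, so the bracket
   (X, u), (Y, v) |-> X v - Y u is that of a semidirect product and satisfies the
   Jacobi identity strictly. Both V_0 (functions on U_ij) and V_1 (functions on
   U_i) carry this bracket, whence J = 0. The bracket preserves the cocycle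
   condition because d (g^-1 dg) = 0: for g = a + ib of modulus 1 the 1-form
   g^-1 dg is i (a db - b da), and da, db are linearly dependent since
   a da + b db = 0. *)

(** * Restriction and products of [Ck] functions in Euclidean space *)

Section SmoothnessClosure.
Variables (R : realType) (n : nat).
Implicit Types (A B : set 'rV[R]_n) (f g : 'rV[R]_n -> R).

Lemma Ck_sub k A B f : B `<=` A -> Ck k A f -> Ck k B f.
Proof.
move=> BA; elim: k f => [|k IH] f /= [cf df]; first by split=> // x /BA/cf.
split=> [x /BA/cf //|i].
by have [d1 d2] := df i; split=> [x /BA/d1 //|]; exact: IH.
Qed.

Lemma CkW k A f : Ck k.+1 A f -> Ck k A f.
Proof.
elim: k f => [|k IH] f [cf df]; split => // i.
by have [d1 d2] := df i; split=> //; exact: IH.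
Qed.

(** Induction on [k] through the Leibniz rule: the partial derivatives of [f] and [g] are in [Ck k],
    and [CkW] lowers the undifferentiated factors to the same order. *)
Lemma CkM k A f g : open A -> Ck k A f -> Ck k A g ->
  Ck k A (fun x => f x * g x).
Proof.
move=> oA; elim: k f g => [|k IH] f g.
  by move=> [cf _] [cg _]; split=> // x Ax; exact: (cvgM (cf x Ax) (cg x Ax)).
move=> Cf Cg; have [cf df] := Cf; have [cg dg] := Cg; split.
  by move=> x Ax; exact: (cvgM (cf x Ax) (cg x Ax)).
move=> i; have [df1 df2] := df i; have [dg1 dg2] := dg i; split.
  by move=> x Ax; apply: derivableM; [exact: df1|exact: dg1].
have := CkP 1 oA (IH _ _ (CkW Cf) dg2) (IH _ _ (CkW Cg) df2).
apply: Ck_ext => // x Ax.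
rewrite -[RHS]/('D_(delta_mx 0 i) (f * g) x) deriveM ?mul1r //.
- exact: df1.
- exact: dg1.
Qed.

End SmoothnessClosure.

(** * Smooth functions on open subsets of [M] and the local rules for derivations *)

Section VectorFieldCalculus.
Variables (R : realType) (n : nat) (M : smooth_manifold R n).
Implicit Types (W : set M) (f g : M -> R) (u v : M -> Rcomplex R) (p : M).
Implicit Types (X Y Z : vector_field M).

Lemma smooth_on_sub W W' f : W' `<=` W -> smooth_on W f -> smooth_on W' f.
Proof.
by move=> WW sf c Ac k; apply: Ck_sub (sf c Ac k) => y [Iy /WW].
Qed.

Lemma smooth_on_ext W f g : open W -> (forall p, W p -> f p = g p) ->
  smooth_on W f -> smooth_on W g.
Proof.
move=> oW fg sf c Ac k; apply: Ck_ext (sf c Ac k); first exact: open_in_chart.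
by move=> y [_ Wy]; exact: fg.
Qed.

Lemma smooth_onM W f g : open W -> smooth_on W f -> smooth_on W g ->
  smooth_on W (fun p => f p * g p).
Proof.
move=> oW sf sg c Ac k.
by apply: (@CkM _ _ k _ (f \o of_coord c) (g \o of_coord c));
  [exact: open_in_chart | exact: sf | exact: sg].
Qed.

Lemma smooth_onD W f g : open W -> smooth_on W f -> smooth_on W g ->
  smooth_on W (fun p => f p + g p).
Proof.
move=> oW sf sg; apply: smooth_on_ext (smooth_onP 1 oW sf sg) => // p _.
by rewrite mul1r.
Qed.

Lemma smooth_onB W f g : open W -> smooth_on W f -> smooth_on W g ->
  smooth_on W (fun p => f p - g p).
Proof.
move=> oW sf sg; apply: smooth_on_ext (smooth_onP (-1) oW sg sf) => // p _.
by rewrite mulN1r addrC.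
Qed.

Lemma smooth_near2 p f g : smooth_near p f -> smooth_near p g ->
  exists W, [/\ open W, W p, smooth_on W f & smooth_on W g].
Proof.
move=> [W [oW Wp] sf] [W' [oW' Wp'] sg]; exists (W `&` W'); split => //.
- exact: openI.
- exact: smooth_on_sub sf.
- exact: smooth_on_sub sg.
Qed.

Lemma smooth_nearW W p f : open W -> W p -> smooth_on W f -> smooth_near p f.
Proof. by move=> oW Wp sf; exists W. Qed.

Lemma vector_fieldP X : is_vector_field X.
Proof. by case: X => X /= /asboolP. Qed.

Lemma vf_smooth X W f : open W -> smooth_on W f ->
  smooth_on W (fun p => X p f).
Proof. by have [_ sX] := vector_fieldP X; exact: sX. Qed.

(** Tangent vectors act on germs. This locality lets a function be replaced, under a derivation, by
    any formula valid on an open neighbourhood of the point. *)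
Lemma vf_eq X W f g p : open W -> W p -> smooth_on W f ->
  (forall q, W q -> f q = g q) -> X p f = X p g.
Proof.
move=> oW Wp sf fg; have [gX _ _ _] := vector_field_tangent (vector_fieldP X) p.
apply: gX; first exact: smooth_nearW sf.
by apply: filterS (open_nbhs_nbhs (conj oW Wp)) => q /fg.
Qed.

Lemma vfP X (a : R) W f g p : open W -> W p -> smooth_on W f -> smooth_on W g ->
  X p (fun q => a * f q + g q) = a * X p f + X p g.
Proof.
move=> oW Wp sf sg; have [_ lX _ _] := vector_field_tangent (vector_fieldP X) p.
by apply: lX; exact: smooth_nearW oW Wp _.
Qed.

Lemma vfD X W f g p : open W -> W p -> smooth_on W f -> smooth_on W g ->
  X p (fun q => f q + g q) = X p f + X p g.
Proof.
move=> oW Wp sf sg; rewrite -[X p f]mul1r -(vfP X 1 oW Wp sf sg).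
by apply: (vf_eq _ oW Wp); [exact: smooth_onD|move=> q _; rewrite mul1r].
Qed.

Lemma vfB X W f g p : open W -> W p -> smooth_on W f -> smooth_on W g ->
  X p (fun q => f q - g q) = X p f - X p g.
Proof.
move=> oW Wp sf sg; rewrite addrC -mulN1r -(vfP X (-1) oW Wp sg sf).
apply: (vf_eq _ oW Wp); first exact: smooth_onB.
by move=> q _; rewrite mulN1r addrC.
Qed.

Lemma vf0 X p : X p (fun=> 0) = 0.
Proof.
have [_ lX _ _] := vector_field_tangent (vector_fieldP X) p.
have s0 : smooth_near p (fun=> 0 : R).
  by exists setT => //; [split => //; exact: openT|exact: smooth_on0].
(* With scalar [-1] and both functions zero, linearity reads [X p 0 = - X p 0 + X p 0]. *)
by have := lX (-1) _ _ s0 s0; rewrite /= mulr0 addr0 mulN1r addNr.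
Qed.

Lemma vf_eq0 X W f p : open W -> W p -> (forall q, W q -> f q = 0) -> X p f = 0.
Proof.
move=> oW Wp f0; rewrite -(vf0 X p); apply/esym.
by apply: (vf_eq _ oW Wp) => [|q /f0 ->//]; exact: smooth_on0.
Qed.

Lemma vfM X W f g p : open W -> W p -> smooth_on W f -> smooth_on W g ->
  X p (fun q => f q * g q) = f p * X p g + X p f * g p.
Proof.
move=> oW Wp sf sg; have [_ _ bX _] := vector_field_tangent (vector_fieldP X) p.
by apply: bX; exact: smooth_nearW oW Wp _.
Qed.

Lemma vf_junk X p f : ~ smooth_near p f -> X p f = 0.
Proof.
by have [_ _ _ jX] := vector_field_tangent (vector_fieldP X) p; exact: jX.
Qed.

(** * The Lie algebra of vector fields *)

Lemma lie_bracketE X Y W f p : open W -> W p -> smooth_on W f ->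
  lie_bracket X Y p f =
  X p (fun q => Y q f) - Y p (fun q => X q f).
Proof.
move=> oW Wp sf; rewrite /lie_bracket asboolT //; exact: smooth_nearW sf.
Qed.

Lemma lie_bracket_is_vector_field X Y : is_vector_field (lie_bracket X Y).
Proof.
split=> [p|W f oW sf]; last first.
  (* On all of [W] the guard of [lie_bracket] is satisfied, so the bracket is there the plain
     commutator. *)
  apply: (@smooth_on_ext _
    (fun p => X p (fun q => Y q f) - Y p (fun q => X q f))).
  - exact: oW.
  - by move=> p Wp; rewrite (lie_bracketE _ _ oW Wp sf).
  - by apply: smooth_onB => //; do 2 apply: vf_smooth => //.
split.
- move=> f g [W [oW Wp] sf] fg.
  (* The outer derivation needs [q |-> Y q f] and [q |-> Y q g] to agree near [p], not only at [p];
     hence an open [V] on which [f = g] throughout. *)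
  have [V [[oV Vp] VW fV]] : exists V : set M,
      [/\ open_nbhs p V, V `<=` W & forall q, V q -> f q = g q].
    have : nbhs p (W `&` [set q | f q = g q]).
      by apply: filterI => //; exact: open_nbhs_nbhs (conj oW Wp).
    rewrite nbhsE => -[V oV sV]; exists V; split => // q /sV[] //.
  have sfV := smooth_on_sub VW sf; have sgV := smooth_on_ext oV fV sfV.
  rewrite (lie_bracketE _ _ oV Vp sfV) (lie_bracketE _ _ oV Vp sgV).
  by congr (_ - _); apply: (vf_eq _ oV Vp) => [|q Vq]; do ?exact: vf_smooth;
    apply: (vf_eq _ oV Vq).
- move=> a f g sf sg; have [W [oW Wp {}sf {}sg]] := smooth_near2 sf sg.
  rewrite !(lie_bracketE _ _ oW Wp) //; last exact: smooth_onP.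
  have E Z Z' : Z p (fun q => Z' q (fun r => a * f r + g r)) =
      a * Z p (fun q => Z' q f) + Z p (fun q => Z' q g).
    rewrite -(vfP Z a oW Wp) //; do ?exact: vf_smooth.
    apply: (vf_eq _ oW Wp) => [|q Wq]; last exact: vfP oW Wq _ _.
    by apply: vf_smooth => //; exact: smooth_onP.
  by rewrite !E; ring.
- move=> f g sf sg; have [W [oW Wp {}sf {}sg]] := smooth_near2 sf sg.
  rewrite !(lie_bracketE _ _ oW Wp) //; last exact: smooth_onM.
  (* The mixed terms [Z p f * Z' p g + Z' p f * Z p g] are symmetric in [Z] and [Z'], so they cancel
     in the commutator and the Leibniz rule remains. *)
  have E Z Z' : Z p (fun q => Z' q (fun r => f r * g r)) =
      f p * Z p (fun q => Z' q g) + Z p f * Z' p g +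
      (Z' p f * Z p g + Z p (fun q => Z' q f) * g p).
    have [sf' sg'] := (vf_smooth Z' oW sf, vf_smooth Z' oW sg).
    rewrite -(vfM Z oW Wp sf sg') -(vfM Z oW Wp sf' sg).
    rewrite -(vfD Z oW Wp); [|exact: smooth_onM..].
    apply: (vf_eq _ oW Wp) => [|q Wq]; last exact: vfM oW Wq _ _.
    by apply: vf_smooth => //; exact: smooth_onM.
  by rewrite !E; ring.
- by move=> f nf; rewrite /lie_bracket asboolF.
Qed.

Definition vf_bracket X Y : vector_field M :=
  VectorField (asboolT (lie_bracket_is_vector_field X Y)).

(** On a function that is not smooth near [p] both fields take the conventional value [0], so
    identities need checking on smooth germs only. *)
Lemma vector_field_ext X Y :
  (forall p f, smooth_near p f -> X p f = Y p f) -> X = Y.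
Proof.
move=> XY; apply: val_inj; apply/funext => p; apply/funext => f /=.
by have [/XY //|nf] := pselect (smooth_near p f); rewrite !vf_junk.
Qed.

Lemma vf_bracket_anti X Y : vf_bracket X Y = - vf_bracket Y X.
Proof.
apply: vector_field_ext => p f [W [oW Wp] sf].
rewrite -[RHS]/(- lie_bracket Y X p f) -[LHS]/(lie_bracket X Y p f).
by rewrite !(lie_bracketE _ _ oW Wp sf) opprB.
Qed.

Lemma vf_bracket_linear_l Y : linear (vf_bracket ^~ Y).
Proof.
move=> a X Z; apply: vector_field_ext => p f [W [oW Wp] sf].
rewrite -[RHS]/(a * lie_bracket X Y p f + lie_bracket Z Y p f).
rewrite -[LHS]/(lie_bracket (a *: X + Z) Y p f) !(lie_bracketE _ _ oW Wp sf).
rewrite -[X in X - _]/(a * X p (fun q => Y q f) + Z p (fun q => Y q f)).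
rewrite -[fun q => (a *: X + Z) q f]/(fun q => a * X q f + Z q f).
by rewrite (vfP Y a oW Wp); [ring|exact: vf_smooth..].
Qed.

Lemma vf_bracket_jacobi X Y Z :
  vf_bracket X (vf_bracket Y Z) =
  vf_bracket (vf_bracket X Y) Z + vf_bracket Y (vf_bracket X Z).
Proof.
apply: vector_field_ext => p f [W [oW Wp] sf].
rewrite -[RHS]/(lie_bracket (vf_bracket X Y) Z p f +
  lie_bracket Y (vf_bracket X Z) p f).
rewrite -[LHS]/(lie_bracket X (vf_bracket Y Z) p f).
rewrite !(lie_bracketE _ _ oW Wp sf).
(* [E] expands a bracket in outer position and [E'] one under a derivation. Only threefold
   compositions applied to [f] remain, and they match as in any associative algebra of operators. *)
have E T T' h : smooth_on W h -> vf_bracket T T' p h =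
    T p (fun q => T' q h) - T' p (fun q => T q h).
  by move=> sh; rewrite -(lie_bracketE _ _ oW Wp sh).
have E' (S T T' : vector_field M) : S p (fun q => vf_bracket T T' q f) =
    S p (fun q => T q (fun r => T' r f)) - S p (fun q => T' q (fun r => T r f)).
  rewrite -(vfB S oW Wp); [|by do 2 apply: vf_smooth => //..].
  apply: (vf_eq _ oW Wp) => [|q Wq]; last exact: lie_bracketE oW Wq sf.
  exact: vf_smooth.
rewrite !E; [|exact: vf_smooth..].
rewrite !E'; ring.
Qed.

(** * Lie derivatives of complex-valued and of iR-valued functions *)

Lemma lie_derivative_eq X W u v p : open W -> W p -> csmooth_on W u ->
  (forall q, W q -> u q = v q) -> lie_derivative X u p = lie_derivative X v p.
Proof.
move=> oW Wp [ru iu] uv; congr (_ +i* _)%C.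
- by apply: (vf_eq _ oW Wp ru) => q /uv ->.
- by apply: (vf_eq _ oW Wp iu) => q /uv ->.
Qed.

Lemma lie_derivativeP X (a : R) W u v p : open W -> W p ->
  csmooth_on W u -> csmooth_on W v ->
  lie_derivative X (a *: u + v) p =
  a *: lie_derivative X u p + lie_derivative X v p.
Proof.
move=> oW Wp su sv; have [ruv iuv] := csmooth_onP a oW su sv.
have [[ru iu] [rv iv]] := (su, sv).
rewrite -[RHS]/((a * _ + _) +i* (a * _ + _))%C.
congr (_ +i* _)%C; rewrite -(vfP X a oW Wp) //; apply: (vf_eq _ oW Wp) => //.
- move=> q _; rewrite -[(_ + _) q]/(a *: u q + v q).
  by case: (u q) (v q) => ? ? [].
- move=> q _; rewrite -[(_ + _) q]/(a *: u q + v q).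
  by case: (u q) (v q) => ? ? [].
Qed.

Lemma csmooth_on_sub W W' u : W' `<=` W -> csmooth_on W u -> csmooth_on W' u.
Proof. by move=> WW [ru iu]; split; exact: smooth_on_sub WW _. Qed.

Lemma csmooth_onD W u v : open W -> csmooth_on W u -> csmooth_on W v ->
  csmooth_on W (u + v).
Proof. by move=> oW su sv; rewrite -[u]scale1r; exact: csmooth_onP. Qed.

Lemma csmooth_onB W u v : open W -> csmooth_on W u -> csmooth_on W v ->
  csmooth_on W (u - v).
Proof.
by move=> oW su sv; rewrite addrC -scaleN1r; exact: csmooth_onP.
Qed.

Lemma lie_derivativeD X W u v p : open W -> W p ->
  csmooth_on W u -> csmooth_on W v ->
  lie_derivative X (u + v) p = lie_derivative X u p + lie_derivative X v p.
Proof.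
move=> oW Wp su sv; rewrite -[u in LHS]scale1r.
by rewrite (lie_derivativeP X 1 oW Wp su sv) scale1r.
Qed.

Lemma lie_derivativeB X W u v p : open W -> W p ->
  csmooth_on W u -> csmooth_on W v ->
  lie_derivative X (u - v) p = lie_derivative X u p - lie_derivative X v p.
Proof.
move=> oW Wp su sv; rewrite addrC -scaleN1r.
by rewrite (lie_derivativeP X (-1) oW Wp sv su) scaleN1r addrC.
Qed.

(** Extension by [0] is imposed again after differentiation, because a derivative can be nonzero off
    [W] even if [u] vanishes there: take [u = ix] on the real line minus the origin, at the
    origin. *)
Definition lie_on W X u : M -> Rcomplex R :=
  patch (fun=> 0) W (lie_derivative X u).

Lemma lie_onE W X u p : W p -> lie_on W X u p = lie_derivative X u p.
Proof. by move=> Wp; rewrite /lie_on patchT // inE. Qed.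

Lemma patch_out W (u : M -> Rcomplex R) p : ~ W p -> patch (fun=> 0) W u p = 0.
Proof. by move=> nW; rewrite patchC // inE. Qed.

Lemma lie_on_out W X u p : ~ W p -> lie_on W X u p = 0.
Proof. exact: patch_out. Qed.

(** A jump across the boundary of [W] is harmless, since smoothness on the open set [W] depends only
    on the values in [W]. *)
Lemma patch_iR W u : open W -> csmooth_on W u ->
  (forall p, W p -> complex.Re (u p) = 0) ->
  is_iR_function W (patch (fun=> 0) W u).
Proof.
move=> oW [ru iu] u0; split=> [|p Wp|p]; last exact: patch_out.
- split; [apply: smooth_on_ext ru|apply: smooth_on_ext iu] => // p Wp.
  + by rewrite patchT ?inE.
  + by rewrite patchT ?inE.
- by rewrite patchT ?inE //; exact: u0.
Qed.

Lemma csmooth_lie W X u : open W -> csmooth_on W u ->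
  csmooth_on W (lie_derivative X u).
Proof. by move=> oW [ru iu]; split; exact: vf_smooth. Qed.

Lemma lie_on_iR W X u : open W -> is_iR_function W u ->
  is_iR_function W (lie_on W X u).
Proof.
move=> oW [su ru _]; apply: patch_iR => // [|p Wp]; first exact: csmooth_lie.
exact: vf_eq0 oW Wp ru.
Qed.

Lemma lie_on_linear W X (a : R) u v : open W ->
  is_iR_function W u -> is_iR_function W v ->
  lie_on W X (a *: u + v) = a *: lie_on W X u + lie_on W X v.
Proof.
move=> oW [su _ _] [sv _ _]; apply/funext => p.
rewrite -[RHS]/(a *: lie_on W X u p + lie_on W X v p).
have [Wp|nW] := pselect (W p); last by rewrite !lie_on_out // scaler0 addr0.
by rewrite !lie_onE // (lie_derivativeP X a oW Wp su sv).
Qed.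

Lemma lie_onB W X u v : open W ->
  is_iR_function W u -> is_iR_function W v ->
  lie_on W X (u - v) = lie_on W X u - lie_on W X v.
Proof.
by move=> oW iu iv; rewrite addrC -scaleN1r lie_on_linear // scaleN1r addrC.
Qed.

Lemma lie_on_linear_field W X Y (a : R) u :
  lie_on W (a *: X + Y) u = a *: lie_on W X u + lie_on W Y u.
Proof.
apply/funext => p; rewrite -[RHS]/(a *: lie_on W X u p + lie_on W Y u p).
have [Wp|nW] := pselect (W p); last by rewrite !lie_on_out // scaler0 addr0.
by rewrite !lie_onE.
Qed.

Lemma lie_on_field0 W u : lie_on W 0 u = 0.
Proof.
(* As for [vf0], linearity at zero arguments with scalar [-1] forces the value [0]; the same device
   recurs for the brackets below. *)
have := lie_on_linear_field W 0 0 (-1) u.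
by rewrite scaler0 addr0 scaleN1r addNr.
Qed.

Lemma lie_on_bracket W X Y u : open W -> is_iR_function W u ->
  lie_on W (vf_bracket X Y) u =
  lie_on W X (lie_on W Y u) - lie_on W Y (lie_on W X u).
Proof.
move=> oW [su _ _]; apply/funext => p.
rewrite -[RHS]/(lie_on W X (lie_on W Y u) p - lie_on W Y (lie_on W X u) p).
have [Wp|nW] := pselect (W p); last by rewrite !lie_on_out // subr0.
rewrite !lie_onE //.
(* The inner extension by [0] does not change the germ at a point of the open set [W]. *)
have E S T : lie_derivative S (lie_on W T u) p =
    lie_derivative S (lie_derivative T u) p.
  apply/esym; apply: (lie_derivative_eq _ oW Wp) => [|q Wq].
    exact: csmooth_lie.
  by rewrite lie_onE.
rewrite !E; have [ru iu] := su.
rewrite -[RHS]/((_ - _) +i* (_ - _))%C.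
by congr (_ +i* _)%C; exact: (lie_bracketE _ _ oW Wp).
Qed.

(** * The function component of the semidirect product bracket *)

Definition iR_bracket W X u Y v : M -> Rcomplex R :=
  lie_on W X v - lie_on W Y u.

Lemma iR_bracket_iR W X u Y v : open W ->
  is_iR_function W u -> is_iR_function W v ->
  is_iR_function W (iR_bracket W X u Y v).
Proof.
move=> oW iu iv; rewrite /iR_bracket addrC -scaleN1r.
by apply: is_iR_functionP => //; exact: lie_on_iR.
Qed.

Lemma iR_bracket_anti W X u Y v :
  iR_bracket W X u Y v = - iR_bracket W Y v X u.
Proof. by rewrite /iR_bracket opprB. Qed.

Lemma iR_bracket_linear_l W X u Y v Z w (a : R) : open W ->
  is_iR_function W u -> is_iR_function W v ->
  iR_bracket W (a *: X + Y) (a *: u + v) Z w =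
  a *: iR_bracket W X u Z w + iR_bracket W Y v Z w.
Proof.
move=> oW iu iv; rewrite /iR_bracket lie_on_linear_field lie_on_linear //.
by rewrite scalerBr opprD addrACA.
Qed.

Lemma iR_bracket_jacobi W X u Y v Z w : open W ->
  is_iR_function W u -> is_iR_function W v -> is_iR_function W w ->
  iR_bracket W X u (vf_bracket Y Z) (iR_bracket W Y v Z w) =
  iR_bracket W (vf_bracket X Y) (iR_bracket W X u Y v) Z w +
  iR_bracket W Y v (vf_bracket X Z) (iR_bracket W X u Z w).
Proof.
move=> oW iu iv iw; have iL T t := @lie_on_iR W T t oW.
(* Once the derivatives along brackets are expanded, the terms [Y X w] and [Z X v] cancel on the
   right, and both sides equal [X Y w - X Z v - Y Z u + Z Y u]. *)
rewrite /iR_bracket !lie_onB; try by [|apply: iL].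
rewrite !lie_on_bracket //; apply/funext => p.
rewrite !fctE; set a := lie_on _ _ _ _; ring.
Qed.

(** * Circle-valued functions and the closedness of [g^-1 dg] *)

(* [f = a^2 + b^2] is idempotent on [W], so [X f = 2 f (X f) = 2 (X f)]. *)
Lemma vf_circle X W (a b : M -> R) p : open W -> W p ->
  smooth_on W a -> smooth_on W b ->
  (forall q, W q -> a q * a q + b q * b q = 1) ->
  a p * X p a + b p * X p b = 0.
Proof.
move=> oW Wp sa sb ab1.
pose f q := a q * a q + b q * b q.
have sf : smooth_on W f by apply: smooth_onD => //; exact: smooth_onM.
have Xff : X p f = X p (fun q => f q * f q).
  by apply: (vf_eq _ oW Wp sf) => q /ab1; rewrite /f => ->; rewrite mulr1.
have Xf0 : X p f = 0.
  have fp : f p = 1 by exact: ab1.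
  have := Xff; rewrite (vfM X oW Wp sf sf) fp mul1r mulr1 => /eqP.
  by rewrite -subr_eq0 opprD addrA subrr add0r oppr_eq0 => /eqP.
have := Xf0; rewrite (vfD X oW Wp); [|exact: smooth_onM..].
rewrite !(vfM X oW Wp) // => E.
have : 2 * (a p * X p a + b p * X p b) = 0 by rewrite -[RHS]E; ring.
by move/eqP; rewrite mulf_eq0 pnatr_eq0 => /eqP.
Qed.

(** By [vf_circle], the vectors [(X a, X b)] and [(Y a, Y b)] of the plane are both orthogonal to
    the unit vector [(a, b)], so their determinant is zero. *)
Lemma vf_circle_wedge X Y W (a b : M -> R) p : open W -> W p ->
  smooth_on W a -> smooth_on W b ->
  (forall q, W q -> a q * a q + b q * b q = 1) ->
  X p a * Y p b = Y p a * X p b.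
Proof.
move=> oW Wp sa sb ab1; apply/eqP; rewrite -subr_eq0; apply/eqP.
have EX := vf_circle X oW Wp sa sb ab1; have EY := vf_circle Y oW Wp sa sb ab1.
rewrite -[LHS]mul1r -(ab1 p Wp).
(* The determinant times [a^2 + b^2], written as a combination of the two orthogonality
   relations. *)
transitivity ((a p * X p a + b p * X p b) * (a p * Y p b - b p * Y p a) -
  (a p * Y p a + b p * Y p b) * (a p * X p b - b p * X p a)); first by ring.
by rewrite EX EY !mul0r subrr.
Qed.

Lemma circle_sqr (z : Rcomplex R) : `|z| = 1 ->
  complex.Re z * complex.Re z + complex.Im z * complex.Im z = 1.
Proof.
case: z => a b; rewrite -[`|_|]/(Num.sqrt (a ^+ 2 + b ^+ 2)) /= -!expr2 => ab.
by rewrite -[LHS]sqr_sqrtr ?addr_ge0 ?sqr_ge0 // ab expr1n.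
Qed.

(** The contraction of [X] with [a db - b da] for [h = a + ib]; when [h] has modulus 1 this form is
    locally the differential of the argument of [h]. *)
Definition im_dlog X (h : M -> Rcomplex R) p : R :=
  complex.Re (h p) * X p (fun q => complex.Im (h q)) -
  complex.Im (h p) * X p (fun q => complex.Re (h q)).

Lemma iota_dlog_circle X W (h : M -> Rcomplex R) p : open W -> W p ->
  csmooth_on W h -> (forall q, W q -> `|h q| = 1) ->
  iota_dlog X h p = (0 +i* im_dlog X h p)%C.
Proof.
move=> oW Wp [rh ih] h1.
have hsqr q Wq := circle_sqr (h1 q Wq).
have := vf_circle X oW Wp rh ih hsqr; have := hsqr p Wp.
rewrite /iota_dlog /im_dlog /lie_derivative.
case: (h p) => a b /= ab1; set Xa := X p _; set Xb := X p _ => Xab.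
(* The inverse of [a + ib] is [(a - ib) / (a^2 + b^2)], with denominator [1] here. The real part of
   the product is then [a X a + b X b], which vanishes by [Xab]. *)
rewrite -[LHS]/((_ - _) +i* (_ + _))%C /= !expr2 ab1 !divr1.
by congr (_ +i* _)%C; [rewrite -[RHS]Xab; ring|ring].
Qed.

(** The difference of the two sides is [(d theta)(X, Y)] for [theta = h^-1 dh], by Cartan's formula,
    and [theta] is closed. *)
Lemma iota_dlog_bracket X Y W (h : M -> Rcomplex R) p : open W -> W p ->
  csmooth_on W h -> (forall q, W q -> `|h q| = 1) ->
  lie_derivative X (iota_dlog Y h) p - lie_derivative Y (iota_dlog X h) p =
  iota_dlog (vf_bracket X Y) h p.
Proof.
move=> oW Wp sh h1; have [rh ih] := sh.
pose a q := complex.Re (h q); pose b q := complex.Im (h q).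
have E S T : lie_derivative S (iota_dlog T h) p = (0 +i*
    (S p a * T p b + a p * S p (fun q => T q b) -
    (S p b * T p a + b p * S p (fun q => T q a))))%C.
  have [sTa sTb] := (vf_smooth T oW rh, vf_smooth T oW ih).
  have [saTb sbTa] := (smooth_onM oW rh sTb, smooth_onM oW ih sTa).
  have sT : csmooth_on W (fun q => (0 +i* im_dlog T h q)%C).
    by split; [exact: smooth_on0|exact: smooth_onB].
  (* The explicit form of [iota_dlog T h] holds on [W], where [h] has modulus 1, and this determines
     its germ at [p]. *)
  rewrite -(lie_derivative_eq S oW Wp sT) => [|q Wq]; last first.
    by rewrite (iota_dlog_circle T oW Wq sh h1).
  congr (_ +i* _)%C; first exact: vf0.
  rewrite -[LHS]/(S p (fun q => a q * T q b - b q * T q a)).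
  by rewrite (vfB S oW Wp saTb sbTa) !(vfM S oW Wp) //; ring.
rewrite !E (iota_dlog_circle _ oW Wp sh h1).
(* Besides the second-order terms, which assemble into the bracket, the difference contains
   [2 (X a * Y b - X b * Y a)]; [W1] makes it vanish. *)
have W1 := vf_circle_wedge X Y oW Wp rh ih (fun q Wq => circle_sqr (h1 q Wq)).
rewrite -[LHS]/((0 - 0) +i* (_ - _))%C; congr (_ +i* _)%C; first exact: subrr.
have B f : smooth_on W f -> vf_bracket X Y p f =
    X p (fun q => Y q f) - Y p (fun q => X q f).
  by move=> sf; exact: lie_bracketE oW Wp sf.
rewrite /im_dlog !B // -/a -/b -/(a p) -/(b p) in W1 *.
rewrite W1 [X p b * _]mulrC -W1; ring.
Qed.

End VectorFieldCalculus.

(** * Objects and cochains over the cover *)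

Section LinftyStructure.
Variables (R : realType) (n : nat) (M : smooth_manifold R n) (I : Type).
Variables (U : good_open_cover M I) (g : cech_2cocycle U).
Implicit Types (X Y Z : vector_field M) (x y z : cech_object g).
Implicit Types (u v w : iR_cochain U).

Local Notation U2 i j := (U i `&` U j).

Lemma open2 i j : open (U2 i j).
Proof. by apply: openI; exact: cover_open. Qed.

Lemma open3 i j k : open (U i `&` U j `&` U k).
Proof. by apply: openI; [exact: open2|exact: cover_open]. Qed.

Lemma iR_cochainP u i : is_iR_function (U i) (u i).
Proof. by case: u => u pu; have /asboolP := pu; apply. Qed.

Lemma ob_fun_iR x i j : is_iR_function (U2 i j) (ob_fun x i j).
Proof. by case: x => x px; have /asboolP[+ _] := px; apply. Qed.

Lemma ob_fun_cocycle x i j k p : U i p -> U j p -> U k p ->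
  ob_fun x j k p - ob_fun x i k p + ob_fun x i j p =
  iota_dlog (ob_field x) (g i j k) p.
Proof. by case: x => x px; have /asboolP[_] := px; apply. Qed.

Lemma cech_object_ext x y : ob_field x = ob_field y ->
  (forall i j, ob_fun x i j = ob_fun y i j) -> x = y.
Proof.
move=> e0 e1; apply: val_inj; move: e0 e1; rewrite /ob_field /ob_fun /=.
case: (cech_object_val x) (cech_object_val y) => [X f] [Y h] /= -> e.
by congr pair; apply/funext => i; apply/funext => j.
Qed.

Lemma iR_cochain_ext u v : (forall i, u i = v i) -> u = v.
Proof. by move=> e; apply: val_inj; apply/funext. Qed.

(** * The brackets on the two terms and the differential between them *)

Definition ob_bracket_val x y :
    vector_field M * (I -> I -> M -> Rcomplex R) :=
  (vf_bracket (ob_field x) (ob_field y),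
   fun i j => iR_bracket (U2 i j) (ob_field x) (ob_fun x i j)
                                  (ob_field y) (ob_fun y i j)).

(** With [X], [Y] the fields of [x], [y]: apply [X] to the cocycle identity of [y], apply [Y] to
    that of [x], and subtract. The right-hand sides combine by [iota_dlog_bracket] on the triple
    intersection. *)
Lemma ob_bracket_subproof x y : ob_bracket_val x y \in cech_object_pred g.
Proof.
apply/asboolP; split=> [i j|i j k p Ui Uj Uk] /=.
  by apply: iR_bracket_iR; [exact: open2|exact: ob_fun_iR..].
have W3 : (U i `&` U j `&` U k) p by [].
rewrite -(iota_dlog_bracket _ _ (open3 i j k) W3).
- have E X z :
      lie_derivative X (iota_dlog (ob_field z) (g i j k)) p =
      lie_on (U2 j k) X (ob_fun z j k) p - lie_on (U2 i k) X (ob_fun z i k) p +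
      lie_on (U2 i j) X (ob_fun z i j) p.
    (* The three functions live on different double intersections; restricted to [U_ijk], they allow
       the cocycle identity to be differentiated term by term. *)
    have sub l m : U i `&` U j `&` U k `<=` U2 l m ->
        csmooth_on (U i `&` U j `&` U k) (ob_fun z l m).
      by move=> s; have [sz _ _] := ob_fun_iR z l m; exact: csmooth_on_sub sz.
    have [sjk sik sij] : [/\ csmooth_on (U i `&` U j `&` U k) (ob_fun z j k),
        csmooth_on (U i `&` U j `&` U k) (ob_fun z i k) &
        csmooth_on (U i `&` U j `&` U k) (ob_fun z i j)].
      by split; apply: sub => q [[]].
    have o3 := open3 i j k; have sB := csmooth_onB o3 sjk sik.
    rewrite -(lie_derivative_eq X o3 W3 (csmooth_onD o3 sB sij)).
      rewrite (lie_derivativeD X o3 W3) // (lie_derivativeB X o3 W3) //.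
      by rewrite !lie_onE.
    by move=> q [[Ui' Uj'] Uk']; exact: ob_fun_cocycle.
  rewrite !E /iR_bracket !fctE; ring.
- exact: cocycle_smooth.
- by move=> q [[? ?] ?]; exact: cocycle_circle.
Qed.

Definition ob_bracket x y : cech_object g :=
  CechObject (ob_bracket_subproof x y).

(** Truncation is needed because [u i] may be nonzero on the part of [U i] outside [U j]. *)
Definition coboundary_val u : vector_field M * (I -> I -> M -> Rcomplex R) :=
  (0, fun i j => patch (fun=> 0) (U2 i j) (u i - u j)).

(** The alternating sum of the differences [u i - u j] telescopes to [0], which is also the
    contraction of [g^-1 dg] with the zero field. *)
Lemma coboundary_subproof u : coboundary_val u \in cech_object_pred g.
Proof.
apply/asboolP; split=> [i j|i j k p Ui Uj Uk] /=.
  have [[si ri _] [sj rj _]] := (iR_cochainP u i, iR_cochainP u j).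
  apply: patch_iR; first exact: open2.
  - apply: csmooth_onB; first exact: open2.
    + by apply: csmooth_on_sub si => q [].
    + by apply: csmooth_on_sub sj => q [].
  - move=> p [/ri + /rj]; rewrite !fctE.
    by case: (u i p) (u j p) => [? ?] [? ?] /= -> ->; rewrite subrr.
rewrite !patchT ?inE // !fctE /iota_dlog.
rewrite -[lie_derivative _ _ _]/(0 : Rcomplex R); ring.
Qed.

Definition coboundary u : cech_object g := CechObject (coboundary_subproof u).

Lemma coboundary_linear : linear coboundary.
Proof.
move=> a u v; apply: cech_object_ext => [|i j].
  by rewrite -[LHS]/0 -[RHS]/(a *: 0 + 0) scaler0 addr0.
apply/funext => p; rewrite -[RHS]/(a *: ob_fun (coboundary u) i j p +
  ob_fun (coboundary v) i j p).
have [Wp|nW] := pselect (U2 i j p); last first.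
  by rewrite /ob_fun /= !patch_out // scaler0 addr0.
rewrite /ob_fun /= !patchT ?inE // !fctE.
by rewrite scalerBr opprD addrACA.
Qed.

HB.instance Definition _ :=
  GRing.isLinear.Build R (iR_cochain U) (cech_object g) _ coboundary
    coboundary_linear.

Lemma cochain_bracket_subproof X u Y v :
  (fun i => iR_bracket (U i) X (u i) Y (v i)) \in @iR_cochain_pred _ _ _ _ U.
Proof.
apply/asboolP => i; apply: iR_bracket_iR; first exact: cover_open.
- exact: iR_cochainP.
- exact: iR_cochainP.
Qed.

Definition cochain_bracket X u Y v : iR_cochain U :=
  IRCochain (cochain_bracket_subproof X u Y v).

Lemma ob_bracket_linear_l y : linear (ob_bracket^~ y).
Proof.
move=> a x z; apply: cech_object_ext => [|i j].
  exact: vf_bracket_linear_l.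
rewrite -[RHS]/(a *: iR_bracket (U2 i j) (ob_field x) (ob_fun x i j)
    (ob_field y) (ob_fun y i j) +
  iR_bracket (U2 i j) (ob_field z) (ob_fun z i j) (ob_field y) (ob_fun y i j)).
by rewrite -iR_bracket_linear_l; [|exact: open2|exact: ob_fun_iR..].
Qed.

Lemma cochain_bracket_linear_l X u Z w Y v (a : R) :
  cochain_bracket (a *: X + Z) (a *: u + w) Y v =
  a *: cochain_bracket X u Y v + cochain_bracket Z w Y v.
Proof.
apply: iR_cochain_ext => i.
rewrite -[RHS]/(a *: iR_bracket (U i) X (u i) Y (v i) +
  iR_bracket (U i) Z (w i) Y (v i)).
by rewrite -iR_bracket_linear_l; [|exact: cover_open|exact: iR_cochainP..].
Qed.

Lemma ob_bracket_jacobi x y z :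
  ob_bracket x (ob_bracket y z) =
  ob_bracket (ob_bracket x y) z + ob_bracket y (ob_bracket x z).
Proof.
apply: cech_object_ext => [|i j]; first exact: vf_bracket_jacobi.
by apply: iR_bracket_jacobi; [exact: open2|exact: ob_fun_iR..].
Qed.

Lemma cochain_bracket_jacobi X u Y v Z w :
  cochain_bracket X u (vf_bracket Y Z) (cochain_bracket Y v Z w) =
  cochain_bracket (vf_bracket X Y) (cochain_bracket X u Y v) Z w +
  cochain_bracket Y v (vf_bracket X Z) (cochain_bracket X u Z w).
Proof.
apply: iR_cochain_ext => i.
by apply: iR_bracket_jacobi; [exact: cover_open|exact: iR_cochainP..].
Qed.

Lemma ob_bracket_anti x y : ob_bracket x y = - ob_bracket y x.
Proof.
apply: cech_object_ext => [|i j]; first exact: vf_bracket_anti.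
exact: iR_bracket_anti.
Qed.

Lemma cochain_bracket_anti X u Y v :
  cochain_bracket X u Y v = - cochain_bracket Y v X u.
Proof. by apply: iR_cochain_ext => i; exact: iR_bracket_anti. Qed.

(** * The bracket on the total space and its Jacobi identity *)

Local Notation V := (cech_object g * iR_cochain U)%type.

(** The semidirect product of [V_0] with the abelian ideal [V_1], on which an object acts through
    its vector field. All degrees are treated by one formula, so the Jacobi identity needs no case
    distinction. *)
Definition total_bracket (x y : V) : V :=
  (ob_bracket x.1 y.1,
   cochain_bracket (ob_field x.1) x.2 (ob_field y.1) y.2).

Lemma total_bracket_anti (x y : V) : total_bracket x y = - total_bracket y x.
Proof. congr pair; [exact: ob_bracket_anti|exact: cochain_bracket_anti]. Qed.

Lemma total_bracket_linear_l (y : V) : linear (total_bracket^~ y).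
Proof.
move=> a x z; congr pair; first exact: ob_bracket_linear_l.
exact: cochain_bracket_linear_l.
Qed.

Lemma total_bracket_linear_r (x : V) : linear (total_bracket x).
Proof.
move=> a y z; rewrite total_bracket_anti total_bracket_linear_l.
by rewrite opprD -scalerN -!total_bracket_anti.
Qed.

Lemma total_bracket_jacobi (x y z : V) :
  total_bracket x (total_bracket y z) =
  total_bracket (total_bracket x y) z + total_bracket y (total_bracket x z).
Proof.
congr pair; [exact: ob_bracket_jacobi|exact: cochain_bracket_jacobi].
Qed.

(** * Compatibility of the bracket with the differential *)

Lemma vf_bracket0l X : vf_bracket 0 X = 0.
Proof.
have := vf_bracket_linear_l X (-1) 0 0.
by rewrite scaler0 addr0 scaleN1r addNr.
Qed.

Lemma vf_bracket0r X : vf_bracket X 0 = 0.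
Proof. by rewrite vf_bracket_anti vf_bracket0l oppr0. Qed.

Lemma lie_on0 X W : lie_on W X 0 = 0.
Proof.
apply/funext => p; have [Wp|nW] := pselect (W p); last exact: lie_on_out.
rewrite lie_onE // /lie_derivative.
by rewrite [X in (X +i* _)%C](vf0 X p) [X in (_ +i* X)%C](vf0 X p).
Qed.

(** Differentiation is local, so it commutes with restriction from [U i] and [U j] to [U_ij]. This
    is the function component of [[x, d u] = d [x, u]]. *)
Lemma lie_on_coboundary X u i j :
  lie_on (U2 i j) X (ob_fun (coboundary u) i j) =
  patch (fun=> 0) (U2 i j) (lie_on (U i) X (u i) - lie_on (U j) X (u j)).
Proof.
have [[si _ _] [sj _ _]] := (iR_cochainP u i, iR_cochainP u j).
have [si' sj'] : csmooth_on (U2 i j) (u i) /\ csmooth_on (U2 i j) (u j).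
  by split; [apply: csmooth_on_sub si|apply: csmooth_on_sub sj] => q [].
have o2 := open2 i j.
apply/funext => p; have [Wp|nW] := pselect (U2 i j p); last first.
  by rewrite lie_on_out // patch_out.
have [Ui Uj] := Wp.
rewrite lie_onE // patchT ?inE // !fctE !lie_onE //.
rewrite -(lie_derivativeB X o2 Wp si' sj').
apply/esym; apply: (lie_derivative_eq X o2 Wp); first exact: csmooth_onB.
by move=> q Wq; rewrite /ob_fun /= patchT ?inE.
Qed.

Lemma total_bracket_chain (x y : V) :
  total_d coboundary (total_bracket x y) =
  total_bracket (total_d coboundary x) y +
  total_bracket (parity x) (total_d coboundary y).
Proof.
congr pair; last first.
  (* In degree 1 both terms on the right vanish: the values of [total_d] have zero field and zero
     cochain component. *)
  apply: iR_cochain_ext => i.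
  rewrite -[LHS]/(0 : M -> Rcomplex R).
  rewrite -[RHS]/(iR_bracket (U i) 0 0 (ob_field y.1) (y.2 i) +
    iR_bracket (U i) (ob_field x.1) (- x.2 i) 0 0).
  by rewrite /iR_bracket !lie_on_field0 !lie_on0 !subr0 addr0.
apply: cech_object_ext => [|i j].
  rewrite -[LHS]/(0 : vector_field M).
  rewrite -[RHS]/(vf_bracket 0 (ob_field y.1) + vf_bracket (ob_field x.1) 0).
  by rewrite vf_bracket0l vf_bracket0r addr0.
rewrite -[RHS]/(iR_bracket (U2 i j) 0 (ob_fun (coboundary x.2) i j)
    (ob_field y.1) (ob_fun y.1 i j) +
  iR_bracket (U2 i j) (ob_field x.1) (ob_fun x.1 i j)
    0 (ob_fun (coboundary y.2) i j)).
(* With [X], [Y] the fields and [u], [v] the cochains of the two arguments, what remains is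
   [d (X v - Y u) = X (d v) - Y (d u)] on [U_ij]. *)
rewrite /iR_bracket !lie_on_coboundary !lie_on_field0 subr0 sub0r.
apply/funext => p; rewrite !fctE.
have [Wp|nW] := pselect (U2 i j p); last first.
  by rewrite /ob_fun /= !patch_out // oppr0 addr0.
rewrite /ob_fun /= !patchT ?inE // /iR_bracket !fctE; ring.
Qed.

(** * The bracket degree by degree, and the assembled structure *)

Lemma ob_bracket0r x : ob_bracket x 0 = 0.
Proof.
rewrite ob_bracket_anti; have := ob_bracket_linear_l x (-1) 0 0.
by rewrite scaler0 addr0 scaleN1r addNr => ->; rewrite oppr0.
Qed.

Lemma cochain_bracket_deg00 X Y : cochain_bracket X 0 Y 0 = 0.
Proof.
apply: iR_cochain_ext => i.
rewrite -[LHS]/(iR_bracket (U i) X 0 Y 0) -[RHS]/(0 : M -> Rcomplex R).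
by rewrite /iR_bracket !lie_on0 subr0.
Qed.

Lemma cochain_bracket_deg11 u v : cochain_bracket 0 u 0 v = 0.
Proof.
apply: iR_cochain_ext => i.
rewrite -[LHS]/(iR_bracket (U i) 0 (u i) 0 (v i)) -[RHS]/(0 : M -> Rcomplex R).
by rewrite /iR_bracket !lie_on_field0 subr0.
Qed.

(** Here [cochain_bracket X 0 0 u] is the action of [X] on [u]: its other term is a derivative of
    [0] along the zero field. *)
Lemma total_bracket01 x u :
  total_bracket (in0 x) (in1 u) = in1 (cochain_bracket (ob_field x) 0 0 u).
Proof. by congr pair; exact: ob_bracket0r. Qed.

Lemma total_bracket10 u x :
  total_bracket (in1 u) (in0 x) = - in1 (cochain_bracket (ob_field x) 0 0 u).
Proof. by rewrite total_bracket_anti total_bracket01. Qed.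

Lemma total_bracket11 u v : total_bracket (in1 u) (in1 v) = 0.
Proof. by congr pair; [exact: ob_bracket0r|exact: cochain_bracket_deg11]. Qed.

Lemma total_bracket0r (x : V) : total_bracket x 0 = 0.
Proof.
have := total_bracket_linear_r x (-1) 0 0.
by rewrite scaler0 addr0 scaleN1r addNr.
Qed.

Lemma total_bracket0l (x : V) : total_bracket 0 x = 0.
Proof. by rewrite total_bracket_anti total_bracket0r oppr0. Qed.

(** With [J = 0] the homotopy condition becomes the strict Jacobi identity, and every term of the
    coherence law is zero. Ending with [Defined] keeps [Ld], [Lbr] and [LJ] computable in the
    theorem. *)
Definition cech_Linfty : two_term_Linfty (cech_object g) (iR_cochain U).
Proof.
refine (@TwoTermLinfty R (cech_object g) (iR_cochain U) coboundary
  total_bracket (fun _ _ _ => 0) total_bracket_linear_l total_bracket_linear_r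
  _ _ _ _ total_bracket_chain total_bracket_anti _ _ _ _ _ _ _ _ _ _ _) => //.
- by move=> x y; exact: cochain_bracket_deg00.
- by move=> x u; rewrite total_bracket01.
- by move=> u x; rewrite total_bracket10; exact: oppr0.
- exact: total_bracket11.
- by move=> y z a x x'; rewrite scaler0 addr0.
- by move=> y z a x x'; rewrite scaler0 addr0.
- by move=> y z a x x'; rewrite scaler0 addr0.
- move=> x y z; rewrite (total_bracket_jacobi x y z) subrr !addr0.
  by rewrite /total_d (raddf0 coboundary).
- by move=> *; rewrite oppr0.
- by move=> *; rewrite oppr0.
- by move=> x y z w; rewrite !total_bracket0r total_bracket0l !addr0.
Defined.

End LinftyStructure.

Theorem theorem8p18 (R : realType) (n : nat) (M : smooth_manifold R n)
    (I : Type) (U : good_open_cover M I) (g : cech_2cocycle U) :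
  exists L : two_term_Linfty (cech_object g) (iR_cochain U),
    [/\ forall u : iR_cochain U,
          ob_field (Ld L u) = 0 /\
          forall i j p, U i p -> U j p ->
            ob_fun (Ld L u) i j p = u i p - u j p,
        forall x y : cech_object g, exists z : cech_object g,
          [/\ Lbr L (in0 x) (in0 y) = in0 z,
              lie_bracket (ob_field x) (ob_field y) = ob_field z &
              forall i j p, U i p -> U j p ->
                ob_fun z i j p =
                lie_derivative (ob_field x) (ob_fun y i j) p -
                lie_derivative (ob_field y) (ob_fun x i j) p],
        forall (x : cech_object g) (u : iR_cochain U),
          exists v : iR_cochain U,
          [/\ Lbr L (in0 x) (in1 u) = in1 v,
              Lbr L (in1 u) (in0 x) = - in1 v &
              forall i p, U i p ->
                v i p = lie_derivative (ob_field x) (u i) p],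
        forall u v : iR_cochain U, Lbr L (in1 u) (in1 v) = 0 &
        forall x y z, LJ L x y z = 0].
Proof.
exists (cech_Linfty g); split.
- move=> u; split=> // i j p Ui Uj.
  by rewrite /ob_fun /= patchT ?inE.
(* The field equation holds by conversion, since [vf_bracket] only packages [lie_bracket] with its
   proof. *)
- move=> x y; exists (ob_bracket x y); split=> //.
    by congr pair; exact: cochain_bracket_deg00.
  move=> i j p Ui Uj; have Uij : (U i `&` U j) p by [].
  rewrite -(lie_onE (ob_field x) (ob_fun y i j) Uij).
  by rewrite -(lie_onE (ob_field y) (ob_fun x i j) Uij).
- move=> x u; exists (cochain_bracket (ob_field x) 0 0 u); split.
  + exact: total_bracket01.
  + exact: total_bracket10.
  + move=> i p Ui; rewrite -(lie_onE (ob_field x) (u i) Ui).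
    rewrite -[LHS]/(iR_bracket (U i) (ob_field x) 0 0 (u i) p).
    by rewrite /iR_bracket lie_on_field0 subr0.
- exact: total_bracket11.
- by [].
Qed.
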